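(* Let $\Lambda$ be a finite dimensional algebra over a field $K$, let $(M,P)$ be a $\tau$-rigid pair and let $\frac{A}{B}=\frac{M}{\tau M\sqcup\nu P}$ be the corresponding balanced pair. Then the Jasso category $J(M,P)=M^\perp\cap P^\perp\cap{}^\perp\tau M$ in balanced notation is $$J\left(\frac{A}{B}\right)=A^\perp\cap{}^\perp B .$$
   Context: Modules are finitely generated right $\Lambda$-modules. $X^\perp=\{Y:\mathrm{Hom}_\Lambda(X,Y)=0\}$ and ${}^\perp X=\{Y:\mathrm{Hom}_\Lambda(Y,X)=0\}$. $\nu=D\mathrm{Hom}_\Lambda(-,\Lambda)$ is the Nakayama functor, $D=\mathrm{Hom}_K(-,K)$, and $\tau M=\ker(\nu P_1\to\nu P_0)$ for a minimal projective presentation $P_1\to P_0\to M\to0$. A $\tau$-rigid pair $(M,P)$ consists of modules with $\mathrm{Hom}_\Lambda(M,\tau M)=0$, $P$ projective and $\mathrm{Hom}_\Lambda(P,M)=0$. A pair of modules $\frac{A}{B}$ is a balanced pair if $\mathrm{Hom}_\Lambda(A,B)=0$, $B\cong\tau A\sqcup I$ with $I$ injective, and $A\cong\tau^{-1}B\sqcup Q$ with $Q$ projective. The $\tau$-rigid pair $(M,P)$ corresponds bijectively to the balanced pair $\frac{M}{\tau M\sqcup\nu P}$. $J\left(\frac{A}{B}\right)$ denotes the Jasso category $J(M,P)$ of the corresponding $\tau$-rigid pair. *)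

(* Defs.v *)
From HB Require Import structures.
From mathcomp Require Import all_boot all_order all_algebra all_field.
From mathcomp Require Import boolp functions.

Set Implicit Arguments.
Unset Strict Implicit.
Unset Printing Implicit Defensive.

Import GRing.Theory.
Local Open Scope ring_scope.

(* A right L-module is a left module over the converse ring: [m . a] is written
   [(a : L^c) *: m].  The right regular module is [(L^c)^o].  The field K acts
   on a left or right L-module through [k |-> k%:A]. *)
Notation rmodType L := (lmodType L^c).

Section Modules.
Variable R : pzRingType.
Implicit Types M N P I : lmodType R.

Definition finitely_generated M : Prop :=
  exists (n : nat) (g : 'I_n -> M),
    forall x, exists c : 'I_n -> R, x = \sum_(i < n) c i *: g i.

Definition surj M N (f : M -> N) : Prop := forall y, exists x, f x = y.

(* exactness of M --f--> N --g--> P at N *)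
Definition exact_at M N P (f : M -> N) (g : N -> P) : Prop :=
  forall y, g y = 0 <-> exists x, f x = y.

Definition isomorphic M N : Prop := exists f : {linear M -> N}, bijective f.

Definition hom_zero M N : Prop := forall (f : {linear M -> N}) x, f x = 0.

Definition projective P : Prop :=
  forall (M N : lmodType R) (g : {linear M -> N}) (f : {linear P -> N}),
    surj g -> exists h : {linear P -> M}, forall x, g (h x) = f x.

Definition injective_module I : Prop :=
  forall (M N : lmodType R) (g : {linear M -> N}) (f : {linear M -> I}),
    injective g -> exists h : {linear N -> I}, forall x, h (g x) = f x.

Definition superfluous_kernel M N (f : M -> N) : Prop :=
  forall S : {pred M}, submod_closed S ->
    (forall x, exists s k, [/\ s \in S, f k = 0 & x = s + k]) ->
    forall x, x \in S.

Definition essential_image M N (f : M -> N) : Prop :=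
  forall S : {pred N}, submod_closed S ->
    (forall x, f x \in S -> f x = 0) ->
    forall y, y \in S -> y = 0.

Definition minimal_projective_presentation P1 P0 M
    (d : {linear P1 -> P0}) (e : {linear P0 -> M}) : Prop :=
  [/\ finitely_generated P1 /\ projective P1,
      finitely_generated P0 /\ projective P0,
      exact_at d e /\ surj e
    & superfluous_kernel e /\ superfluous_kernel d].

Definition minimal_injective_copresentation N I0 I1
    (i : {linear N -> I0}) (d : {linear I0 -> I1}) : Prop :=
  [/\ finitely_generated I0 /\ injective_module I0,
      finitely_generated I1 /\ injective_module I1,
      injective i /\ exact_at i d
    & essential_image i /\ essential_image d].

(* Full subcategories of the category of finitely generated modules are given by
   predicates on modules. *)
Definition rperp M Y : Prop := finitely_generated Y /\ hom_zero M Y.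

Definition lperp M Y : Prop := finitely_generated Y /\ hom_zero Y M.

End Modules.

(* The right module D N = Hom_K(N, K) of a left module N,
   with (u . a)(n) = u (a n). *)
Section Dual.
Variables (K : fieldType) (L : falgType K) (N : lmodType L).

Definition klinear : {pred N -> K} := fun u =>
  `[< forall (k : K) (x y : N), u (k%:A *: x + y) = k * u x + u y >].

Fact klinear_zmod : zmod_closed klinear.
Proof.
split=> [|u v /asboolP hu /asboolP hv]; apply/asboolP => k x y.
  by change (0 = k * 0 + 0 :> K); rewrite mulr0 addr0.
by rewrite !fctE hu hv mulrBr opprD addrACA.
Qed.
HB.instance Definition _ := GRing.isZmodClosed.Build _ klinear klinear_zmod.

Record kdual := KDual { kdual_fun :> N -> K; _ : kdual_fun \in klinear }.
HB.instance Definition _ := [isSub for kdual_fun].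
HB.instance Definition _ := [Choice of kdual by <:].
HB.instance Definition _ := [SubChoice_isSubZmodule of kdual by <:].

Lemma kdualP (u : kdual) k x y : u (k%:A *: x + y) = k * u x + u y.
Proof. by case: u => u /= /asboolP. Qed.

Lemma kdual_ext (u v : kdual) : u =1 v -> u = v.
Proof. by move=> uv; apply/val_inj/funext. Qed.

Lemma kdualD (u : kdual) x y : u (x + y) = u x + u y.
Proof. by have := kdualP u 1 x y; rewrite !scale1r mul1r. Qed.

Fact kdual_act_subproof (a : L) (u : kdual) : (fun x => u (a *: x)) \in klinear.
Proof.
apply/asboolP => k x y; rewrite scalerDr -kdualP; congr (u (_ + _)).
by rewrite !scalerA mulr_algr mulr_algl.
Qed.
Definition kdual_act (a : L^c) (u : kdual) : kdual := KDual (kdual_act_subproof a u).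

Fact kdual_actA a b u : kdual_act a (kdual_act b u) = kdual_act (a * b) u.
Proof. by apply: kdual_ext => x /=; rewrite scalerA. Qed.
Fact kdual_act1 : left_id 1 kdual_act.
Proof. by move=> u; apply: kdual_ext => x /=; rewrite scale1r. Qed.
Fact kdual_actDr : right_distributive kdual_act +%R.
Proof. by move=> a u v; apply: kdual_ext. Qed.
Fact kdual_actDl u : {morph kdual_act^~ u : a b / a + b}.
Proof. by move=> a b; apply: kdual_ext => x /=; rewrite scalerDl kdualD. Qed.
HB.instance Definition _ := GRing.Zmodule_isLmodule.Build L^c kdual
  kdual_actA kdual_act1 kdual_actDr kdual_actDl.

End Dual.

(* The left module Hom_L(P, L) of a right module P, with (a f)(p) = a (f p). *)
Section HomRegular.
Variables (K : fieldType) (L : falgType K) (P : rmodType L).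

Definition rlinear : {pred P -> L^o} := fun f =>
  `[< linear (f : P -> (L^c)^o) >].

Fact rlinear_submod : submod_closed rlinear.
Proof.
split=> [|a f g /asboolP hf /asboolP hg]; apply/asboolP => b x y.
  by change (0 = b *: 0 + 0 :> (L^c)^o); rewrite scaler0 addr0.
change (a * f (b *: x + y) + g (b *: x + y) =
        (a * f x + g x) * b + (a * f y + g y) :> L).
have -> : f (b *: x + y) = (f x : L) * b + f y :> L by exact: hf.
have -> : g (b *: x + y) = (g x : L) * b + g y :> L by exact: hg.
by rewrite mulrDr mulrDl mulrA addrACA.
Qed.
HB.instance Definition _ :=
  GRing.isSubmodClosed.Build L _ rlinear rlinear_submod.

Record homreg := HomReg { homreg_fun :> P -> L^o; _ : homreg_fun \in rlinear }.
HB.instance Definition _ := [isSub for homreg_fun].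
HB.instance Definition _ := [Choice of homreg by <:].
HB.instance Definition _ := [SubChoice_isSubZmodule of homreg by <:].
HB.instance Definition _ := [SubZmodule_isSubLmodule of homreg by <:].

Lemma homregP (f : homreg) : linear (f : P -> (L^c)^o).
Proof. by case: f => f /= /asboolP. Qed.

Lemma homreg_ext (f g : homreg) : f =1 g -> f = g.
Proof. by move=> fg; apply/val_inj/funext. Qed.

End HomRegular.

Section Nakayama.
Variables (K : fieldType) (L : falgType K).

Definition nu (P : rmodType L) : rmodType L := kdual (homreg P).

Section NuMap.
Variables (P Q : rmodType L) (f : {linear P -> Q}).

Fact homreg_comp_subproof (h : homreg Q) : (fun x => h (f x)) \in @rlinear _ L P.
Proof. by apply/asboolP => b x y; rewrite linearP homregP. Qed.
Definition homreg_comp (h : homreg Q) : homreg P :=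
  HomReg (homreg_comp_subproof h).

Fact nu_map_subproof (u : nu P) :
  (fun h => u (homreg_comp h)) \in @klinear _ L (homreg Q).
Proof.
apply/asboolP => k x y; rewrite -kdualP; congr (u _).
by apply: homreg_ext.
Qed.
Definition nu_map (u : nu P) : nu Q := KDual (nu_map_subproof u).

Fact nu_map_linear : linear nu_map.
Proof.
move=> a u v; apply: kdual_ext => h.
change (u ((a : L) *: homreg_comp h) + v (homreg_comp h) =
        u (homreg_comp ((a : L) *: h)) + v (homreg_comp h)).
by congr (u _ + _); apply: homreg_ext.
Qed.
HB.instance Definition _ := GRing.isLinear.Build L^c (nu P) (nu Q) _ nu_map
  nu_map_linear.
End NuMap.

(* The bimodule D L; its left structure is (a u)(b) = u (b a). *)
Definition DL : rmodType L := kdual L^o.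

Fact DL_lact_subproof (a : L) (u : DL) :
  (fun b : L^o => u ((b : L) * a)) \in @klinear _ L L^o.
Proof.
apply/asboolP => k x y; rewrite -kdualP mulrDl; congr (u (_ + _)).
by rewrite /GRing.scale /= mulrA.
Qed.
Definition DL_lact (a : L) (u : DL) : DL := KDual (DL_lact_subproof a u).

Fact DL_lact_linear a : linear (DL_lact a).
Proof.
move=> b u v; apply: kdual_ext => x /=; congr (u _ + _).
by rewrite /GRing.scale /= mulrA.
Qed.
HB.instance Definition _ a := GRing.isLinear.Build L^c DL DL _ (DL_lact a)
  (DL_lact_linear a).

(* The inverse Nakayama functor Hom_L(D L, -), with (f . a)(u) = f (a u). *)
Section NuInv.
Variable I : rmodType L.

Definition dlinear : {pred DL -> I} := fun f => `[< linear f >].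

Fact dlinear_zmod : zmod_closed dlinear.
Proof.
split=> [|f g /asboolP hf /asboolP hg]; apply/asboolP => b x y.
  by change (0 = b *: 0 + 0 :> I); rewrite scaler0 addr0.
by rewrite !fctE hf hg scalerBr opprD addrACA.
Qed.
HB.instance Definition _ := GRing.isZmodClosed.Build _ dlinear dlinear_zmod.

Record nuinv_type := NuInv { nuinv_fun :> DL -> I; _ : nuinv_fun \in dlinear }.
HB.instance Definition _ := [isSub for nuinv_fun].
HB.instance Definition _ := [Choice of nuinv_type by <:].
HB.instance Definition _ := [SubChoice_isSubZmodule of nuinv_type by <:].

Lemma nuinvP (f : nuinv_type) : linear f.
Proof. by case: f => f /= /asboolP. Qed.

Lemma nuinv_ext (f g : nuinv_type) : f =1 g -> f = g.
Proof. by move=> fg; apply/val_inj/funext. Qed.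

Fact nuinv_act_subproof (a : L) (f : nuinv_type) :
  (fun u => f (DL_lact a u)) \in dlinear.
Proof. by apply/asboolP => b x y; rewrite linearP nuinvP. Qed.
Definition nuinv_act (a : L^c) (f : nuinv_type) : nuinv_type :=
  NuInv (nuinv_act_subproof a f).

Fact nuinv_actA a b f : nuinv_act a (nuinv_act b f) = nuinv_act (a * b) f.
Proof.
apply: nuinv_ext => u /=; congr (f _); apply: kdual_ext => x /=.
by congr (u _); rewrite -mulrA.
Qed.
Fact nuinv_act1 : left_id 1 nuinv_act.
Proof.
move=> f; apply: nuinv_ext => u /=; congr (f _); apply: kdual_ext => x /=.
by rewrite mulr1.
Qed.
Fact nuinv_actDr : right_distributive nuinv_act +%R.
Proof. by move=> a f g; apply: nuinv_ext. Qed.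
Fact nuinv_actDl f : {morph nuinv_act^~ f : a b / a + b}.
Proof.
move=> a b; apply: nuinv_ext => u.
change (f (DL_lact (a + b) u) = f (DL_lact a u) + f (DL_lact b u)).
have := nuinvP f 1 (DL_lact a u) (DL_lact b u); rewrite !scale1r => <-.
by congr (f _); apply: kdual_ext => x /=; rewrite mulrDr kdualD.
Qed.
HB.instance Definition _ := GRing.Zmodule_isLmodule.Build L^c nuinv_type
  nuinv_actA nuinv_act1 nuinv_actDr nuinv_actDl.
End NuInv.

Definition nuinv (I : rmodType L) : rmodType L := nuinv_type I.

Section NuInvMap.
Variables (I J : rmodType L) (f : {linear I -> J}).

Fact nuinv_map_subproof (h : nuinv I) : (fun u => f (h u)) \in @dlinear J.
Proof. by apply/asboolP => b x y; rewrite nuinvP linearP. Qed.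
Definition nuinv_map (h : nuinv I) : nuinv J := NuInv (nuinv_map_subproof h).

Fact nuinv_map_linear : linear nuinv_map.
Proof.
move=> a u v; apply: nuinv_ext => x.
change (f (u (DL_lact a x) + v x) = f (u (DL_lact a x)) + f (v x)).
exact: linearD.
Qed.
HB.instance Definition _ := GRing.isLinear.Build L^c (nuinv I) (nuinv J) _
  nuinv_map nuinv_map_linear.
End NuInvMap.

(* tau and its inverse are defined up to isomorphism: [is_tau M T] says that T
   is a kernel of nu P1 -> nu P0 for a minimal projective presentation of M, and
   [is_tauinv N C] that C is a cokernel of nuinv I0 -> nuinv I1 for a minimal
   injective copresentation of N. *)
Definition is_tau (M T : rmodType L) : Prop :=
  exists (P1 P0 : rmodType L) (d : {linear P1 -> P0}) (e : {linear P0 -> M}),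
    minimal_projective_presentation d e /\
    exists j : {linear T -> nu P1}, injective j /\ exact_at j (nu_map d).

Definition is_tauinv (N C : rmodType L) : Prop :=
  exists (I0 I1 : rmodType L) (i : {linear N -> I0}) (d : {linear I0 -> I1}),
    minimal_injective_copresentation i d /\
    exists q : {linear nuinv I1 -> C}, surj q /\ exact_at (nuinv_map d) q.

(* In the next definitions [tM] stands for tau M. *)
Definition tau_rigid_pair (M P tM : rmodType L) : Prop :=
  [/\ finitely_generated M, is_tau M tM, hom_zero M tM,
      finitely_generated P /\ projective P & hom_zero P M].

Definition Jasso (M P tM X : rmodType L) : Prop :=
  [/\ rperp M X, rperp P X & lperp tM X].

Definition balanced_pair (A B : rmodType L) : Prop :=
  [/\ finitely_generated A /\ finitely_generated B,
      hom_zero A B,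
      exists tA I : rmodType L, [/\ is_tau A tA, finitely_generated I,
        injective_module I & isomorphic B (tA * I)%type]
    & exists tB Q : rmodType L, [/\ is_tauinv B tB, finitely_generated Q,
        projective Q & isomorphic A (tB * Q)%type]].

Definition corresponding_balanced_pair (M P tM A B : rmodType L) : Prop :=
  [/\ balanced_pair A B, isomorphic A M & isomorphic B (tM * nu P)%type].

Definition Jasso_balanced (A B X : rmodType L) : Prop :=
  exists M P tM : rmodType L,
    [/\ tau_rigid_pair M P tM, corresponding_balanced_pair M P tM A B
      & Jasso M P tM X].

End Nakayama.

(* Main.v *)
Require Import Defs.
From HB Require Import structures.
From mathcomp Require Import all_boot all_order all_algebra all_field.
From mathcomp Require Import boolp.

(** The only real content is that, for a finitely generated projective [P] and a
    finitely generated [X], [Hom(P, X) = 0] if and only if [Hom(X, nu P) = 0]: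
    then [J(M, P)] is cut out by [Hom(M, X) = 0], [Hom(X, tau M) = 0] and
    [Hom(X, nu P) = 0], and the last two conditions together say that
    [Hom(X, tau M x nu P) = 0].  The conditions are invariant under isomorphism
    of [A] and [B], so they do not depend on the pair [(M, P)] chosen to
    represent a balanced pair.

    The equivalence is the shadow of the natural isomorphism
    [Hom(X, nu P) = D Hom(P, X)], which is made explicit here by a dual basis
    [(g_i, phi_i)] of [P] ([projective_dual_basis]), that is,
    [p = sum_i g_i phi_i(p)].
    - Every [x] in [X] and [h] in [Hom(P, L)] give a map [p |-> x h(p)] from [P]
      to [X].  If all of these vanish and [F : X -> nu P], expanding [h] as
      [sum_i h(g_i) phi_i] gives
      [F(x)(h) = sum_i F(x h(g_i))(phi_i) = 0].
    - If [f : P -> X] has [f(p) <> 0], take a [K]-linear form [eta] on [X] with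
      [eta (f p) <> 0] ([separating_form]); it exists because [X] is
      finite-dimensional over [K].  Then [F(x)(h) = eta (x h(p))] defines an
      [L]-linear map [X -> nu P], and it is nonzero because
      [sum_i F(f(g_i))(phi_i) = eta (f p)]. *)

Set Implicit Arguments.
Unset Strict Implicit.
Unset Printing Implicit Defensive.

Import GRing.Theory.
Local Open Scope ring_scope.

Definition linear_of (R : pzRingType) (M N : lmodType R) (f : M -> N)
    (lin : linear f) : {linear M -> N} :=
  HB.pack f (GRing.isLinear.Build _ _ _ _ _ lin).

Lemma finitely_generated_fin (R : pzRingType) (M : lmodType R) (I : finType)
    (g : I -> M) :
  (forall x, exists c : I -> R, x = \sum_i c i *: g i) -> finitely_generated M.
Proof.
move=> gP; exists #|I|, (g \o enum_val) => x.
have [c ->] := gP x; exists (c \o enum_val).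
by rewrite (reindex _ (onW_bij _ (enum_val_bij I))).
Qed.

(** * Vanishing of Hom, products and isomorphisms *)

Section HomZero.
Variable R : pzRingType.
Implicit Types M N X Y : lmodType R.

Lemma hom_zero_prod X M N :
  hom_zero X (M * N)%type <-> hom_zero X M /\ hom_zero X N.
Proof.
split=> [h0|[hM hN] f x].
  split=> f x.
    have lin : linear (fun y => (f y, 0) : M * N).
      by move=> a y z; rewrite linearP; congr pair; rewrite /= scaler0 addr0.
    by have [] := h0 (linear_of lin) x.
  have lin : linear (fun y => (0, f y) : M * N).
    by move=> a y z; rewrite linearP; congr pair; rewrite /= scaler0 addr0.
  by have [] := h0 (linear_of lin) x.
have := hM (fst \o f) x; have := hN (snd \o f) x.
by case E : (f x) => [a b] /=; rewrite E /= => -> ->.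
Qed.

Lemma isomorphic_sym M N : isomorphic M N -> isomorphic N M.
Proof.
move=> [f [g fK gK]].
have lin : linear g by exact: (can2_linear fK gK).
exists (linear_of lin).
by exists f.
Qed.

Lemma hom_zero_iso_l M N X : isomorphic M N -> hom_zero M X -> hom_zero N X.
Proof.
move=> [f [g fK gK]] h0 u x.
by have := h0 (u \o f) (g x); rewrite /= gK.
Qed.

Lemma hom_zero_iso_r M N X : isomorphic M N -> hom_zero X N -> hom_zero X M.
Proof.
move=> [f [g fK gK]] h0 u x.
by apply: (can_inj fK); rewrite raddf0; exact: (h0 (f \o u) x).
Qed.

Lemma rperp_iso M N X : isomorphic M N -> rperp M X <-> rperp N X.
Proof.
by move=> iMN; split=> -[fgX h]; split=> //; apply: hom_zero_iso_l h => //;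
  exact: isomorphic_sym.
Qed.

Lemma lperp_iso M N X : isomorphic M N -> lperp M X <-> lperp N X.
Proof.
by move=> iMN; split=> -[fgX h]; split=> //; apply: hom_zero_iso_r h => //;
  exact: isomorphic_sym.
Qed.

End HomZero.

(** * Dual bases and separating linear forms *)

Lemma finitely_generated_free (R : pzRingType) (M : lmodType R) :
  finitely_generated M ->
  exists (n : nat) (pi : {linear 'rV[R]_n -> M}), surj pi.
Proof.
move=> [n [g gM]].
have lin : linear (fun r : 'rV[R]_n => \sum_(i < n) r 0 i *: g i).
  move=> a r s; rewrite scaler_sumr -big_split /=.
  by apply: eq_bigr => i _; rewrite !mxE scalerDl scalerA.
exists n, (linear_of lin).
move=> x; have [c ->] := gM x; exists (\row_i c i).
by apply: eq_bigr => i _; rewrite mxE.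
Qed.

(** Projectivity splits the surjection from a free module of finite rank; the
    [phi i] are the coordinates of the splitting. *)
Lemma projective_dual_basis (R : pzRingType) (P : lmodType R) :
  finitely_generated P -> projective P ->
  exists (n : nat) (g : 'I_n -> P) (phi : 'I_n -> {linear P -> R^o}),
    forall p, p = \sum_(i < n) (phi i p : R) *: g i.
Proof.
move=> /finitely_generated_free[n [pi surj_pi]] projP.
have [s sP] := projP _ _ pi idfun surj_pi.
have lin i : linear (fun p => s p 0 i : R^o).
  by move=> a p q; rewrite linearP !mxE.
exists n, (fun i => pi (delta_mx 0 i)).
exists (fun i => linear_of (lin i)).
move=> p; rewrite -[LHS](sP p) [in LHS](row_sum_delta (s p)) linear_sum /=.
by apply: eq_bigr => i _; rewrite linearZ.
Qed.

(** With [V] a quotient of [K^n], the kernel is the row space of a matrix [A],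
    and the columns of the cokernel of [A] are linear forms on [K^n] that vanish
    together on exactly that kernel: they descend to [V] and separate its
    points. *)
Lemma separating_form (K : fieldType) (V : lmodType K) (x : V) :
  finitely_generated V -> x != 0 ->
  exists eta : {linear V -> K^o}, eta x != 0.
Proof.
move=> /finitely_generated_free[n [pi surj_pi]] x0.
pose lift v := projT1 (cid (surj_pi v)).
have liftK v : pi (lift v) = v by exact: projT2 (cid (surj_pi v)).
pose inker (A : 'M[K]_n) := forall r : 'rV_n, (r <= A)%MS -> pi r = 0.
(* A matrix of maximal rank with rows in the kernel spans the kernel. *)
have [A kerA maxA] : exists2 A, inker A &
    forall B, inker B -> (\rank B <= \rank A)%N.
  pose rk k := `[< exists2 A, inker A & \rank A = k >].
  have rk0 : exists k, rk k.
    exists 0%N; apply/asboolP; exists 0; last exact: mxrank0.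
    by move=> r; rewrite submx0 => /eqP ->; exact: raddf0.
  have rkn k : rk k -> (k <= n)%N.
    by move=> /asboolP[A _ <-]; exact: rank_leq_row.
  case: (ex_maxnP rk0 rkn) => k /asboolP[A kerA rkA] kmax.
  exists A => // B kerB; rewrite rkA; apply: kmax; apply/asboolP.
  by exists B.
have kerE r : pi r = 0 -> (r <= A)%MS.
  move=> r0; have kerAr : inker (A + r)%MS.
    move=> s /sub_addsmxP[[u v]] /= ->.
    rewrite raddfD /= kerA ?submxMl // add0r.
    by rewrite [v]mx11_scalar mul_scalar_mx linearZ /= r0 scaler0.
  have leAr : (A <= A + r)%MS by exact: addsmxSl.
  have leA : (A + r <= A)%MS.
    by rewrite -(geq_leqif (mxrank_leqif_sup leAr)) maxA.
  exact: submx_trans (addsmxSr A r) leA.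
(* The lift is an arbitrary section, but two lifts of the same vector differ by
   an element of the kernel, which the cokernel of A kills. *)
have coker_lift (r : 'rV_n) : lift (pi r) *m cokermx A = r *m cokermx A.
  apply/eqP; rewrite -subr_eq0 -mulmxBl -submxE; apply: kerE.
  by rewrite raddfB /= liftK subrr.
have /existsP[j jP] : [exists j, (lift x *m cokermx A) 0 j != 0].
  apply: contra_neqT x0; rewrite negb_exists => /forallP h.
  rewrite -(liftK x); apply: kerA; rewrite submxE; apply/eqP/rowP => j.
  by rewrite (eqP (negbNE (h j))) mxE.
have lin : linear (fun v => (lift v *m cokermx A) 0 j : K^o).
  move=> a u v; rewrite -[u in lift (a *: u + v)]liftK.
  rewrite -[v in lift (_ + v)]liftK -linearP coker_lift.
  by rewrite mulmxDl -scalemxAl mxE [X in X + _]mxE.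
by exists (linear_of lin).
Qed.

(** * Right modules as vector spaces over the base field *)

Section BaseField.
Variables (K : fieldType) (L : falgType K).

Section Instance.
Variable X : rmodType L.

(** An alias, because a second scaling on [X] itself would compete with that of
    [L^c]. *)
Definition over_base : Type := X.
HB.instance Definition _ := GRing.Zmodule.on over_base.

Definition base_scale (k : K) (x : over_base) : over_base :=
  ((k%:A : L) : L^c) *: (x : X).

Fact base_scaleA a b x : base_scale a (base_scale b x) = base_scale (a * b) x.
Proof.
rewrite /base_scale scalerA; congr (_ *: _).
by change ((b%:A : L) * a%:A = (a * b)%:A); rewrite mulr_algl scalerA mulrC.
Qed.
Fact base_scale1 : left_id 1 base_scale.
Proof. by move=> x; rewrite /base_scale (scale1r (1 : L)) scale1r. Qed.
Fact base_scaleDr : right_distributive base_scale +%R.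
Proof. by move=> a x y; rewrite /base_scale scalerDr. Qed.
Fact base_scaleDl x : {morph base_scale^~ x : a b / a + b}.
Proof. by move=> a b; rewrite /base_scale (scalerDl (1 : L)) scalerDl. Qed.
HB.instance Definition _ := GRing.Zmodule_isLmodule.Build K over_base
  base_scaleA base_scale1 base_scaleDr base_scaleDl.

(** Since [L] is finite-dimensional, the products of a generating family of [X]
    with a basis of [L] span [X] over [K]. *)
Lemma over_base_fg : finitely_generated X -> finitely_generated over_base.
Proof.
move=> [n [g gP]]; pose b := vbasis {: L}.
apply: (@finitely_generated_fin _ over_base ('I_n * 'I_(\dim {: L}))%type
  (fun ij => ((b`_ij.2 : L) : L^c) *: g ij.1)).
move=> x; have [c ->] := gP x.
exists (fun ij => coord b ij.2 (c ij.1)).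
rewrite -(pair_bigA _ (fun i j => base_scale (coord b j (c i))
  (((b`_j : L) : L^c) *: g i))) /=.
apply: eq_bigr => i _.
rewrite [in LHS](coord_vbasis (memvf (c i : L))) scaler_suml.
apply: eq_bigr => j _; rewrite /base_scale scalerA.
apply: (congr1 (fun a : L^c => a *: g i)).
change (coord b j (c i) *: (b`_j : L) = b`_j * (coord b j (c i))%:A).
by rewrite mulr_algr.
Qed.
End Instance.

(** * Vanishing of Hom and the Nakayama functor *)

Lemma homreg_dual_basis (P : rmodType L) :
  finitely_generated P -> projective P ->
  exists (n : nat) (g : 'I_n -> P) (phi : 'I_n -> homreg P),
    forall p, p = \sum_(i < n) ((phi i p : L) : L^c) *: g i.
Proof.
move=> fgP projP.
have [n [g [phi gphi]]] := projective_dual_basis fgP projP.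
have lin i : (phi i : P -> L^o) \in @rlinear _ L P by apply/asboolP/linearP.
by exists n, g, (fun i => HomReg (lin i)).
Qed.

(** By the dual basis, [Hom(P, L)] is generated by the coordinate forms [phi i],
    and the scalar [h (g i)] in front of [phi i] can be moved onto [x], where it
    gives a value of the map [p |-> x h(p)] from [P] to [X]. *)
Lemma hom_zero_nu (P X : rmodType L) :
  finitely_generated P -> projective P -> hom_zero P X -> hom_zero X (nu P).
Proof.
move=> fgP projP h0 F x; apply: kdual_ext => h.
have [n [g [phi gphi]]] := homreg_dual_basis fgP projP.
have xh0 p : ((h p : L) : L^c) *: x = 0.
  have lin : linear (fun p => ((h p : L) : L^c) *: x).
    move=> a q r; rewrite homregP scalerDl; congr (_ + _).
    by rewrite scalerA.
  exact: (h0 (linear_of lin)).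
have hE : h = \sum_(i < n) (h (g i) : L) *: phi i.
  apply: homreg_ext => q.
  rewrite (big_morph (fun u : homreg P => u q) (id1 := 0) (op1 := +%R)) //.
  rewrite [in LHS](gphi q) -[homreg_fun h]/(linear_of (homregP h) : P -> _).
  rewrite linear_sum.
  by apply: eq_bigr => i _; rewrite linearZ.
have Fx0 : F x 0 = 0.
  by apply: (addrI (F x 0)); rewrite -kdualD !addr0.
rewrite hE (big_morph (F x) (kdualD (F x)) Fx0) big1 // => i _.
change ((((h (g i) : L) : L^c) *: F x) (phi i) = 0).
by rewrite -linearZ xh0 linear0.
Qed.

(** A nonzero value [f p] yields the nonzero map [X -> nu P] sending [x] to
    [h |-> eta (x h(p))], for a linear form [eta] with [eta (f p) <> 0]. *)
Lemma hom_zero_of_nu (P X : rmodType L) :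
  finitely_generated P -> projective P -> finitely_generated X ->
  hom_zero X (nu P) -> hom_zero P X.
Proof.
move=> fgP projP fgX h0 f p; apply/eqP/negPn/negP => fp0.
have [n [g [phi gphi]]] := homreg_dual_basis fgP projP.
have [eta etafp] :=
  @separating_form _ (over_base X) (f p) (over_base_fg fgX) fp0.
have klin x : (fun h : homreg P => eta (((h p : L) : L^c) *: x))
    \in klinear (N := homreg P).
  apply/asboolP => k u v.
  change (eta (((k%:A * u p + v p : L) : L^c) *: x) =
          k * eta (((u p : L) : L^c) *: x) + eta (((v p : L) : L^c) *: x)).
  rewrite -[RHS](linearP eta k); congr (eta _).
  change (((k%:A * u p + v p : L) : L^c) *: x =
    ((k%:A : L) : L^c) *: (((u p : L) : L^c) *: x) + ((v p : L) : L^c) *: x).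
  rewrite scalerDl scalerA; congr (_ *: _ + _).
  (* Scalars of K are central in L, so their side is immaterial. *)
  by change (k%:A * (u p : L) = (u p : L) * k%:A); rewrite mulr_algl mulr_algr.
pose F x : nu P := KDual (klin x).
have Flin : linear F.
  move=> a x y; apply: kdual_ext => h.
  change (eta (((h p : L) : L^c) *: (a *: x + y)) =
    eta ((((a : L) * h p : L) : L^c) *: x) + eta (((h p : L) : L^c) *: y)).
  rewrite -[RHS](linearD eta); congr (eta _).
  by rewrite scalerDr scalerA.
have F0 x h : F x h = 0 by rewrite -[F]/(linear_of Flin : X -> nu P) h0.
(* Here eta (f p) is the sum of the F (f (g i)) (phi i). *)
case/eqP: etafp; rewrite [in LHS](gphi p) linear_sum.
rewrite (linear_sum eta) big1 // => i _.
by rewrite linearZ; exact: F0 (f (g i)) (phi i).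
Qed.
End BaseField.

Theorem proposition3p1 (K : fieldType) (L : falgType K) (M P tM : rmodType L)
    (rigid : tau_rigid_pair M P tM) :
  (forall X : rmodType L,
     Jasso M P tM X <-> rperp M X /\ lperp (tM * nu P)%type X) /\
  forall A B : rmodType L, corresponding_balanced_pair M P tM A B ->
    forall X : rmodType L,
      (Jasso_balanced A B X <-> Jasso M P tM X) /\
      (Jasso_balanced A B X <-> rperp A X /\ lperp B X).
Proof.
have jassoE (M' P' tM' X : rmodType L) : tau_rigid_pair M' P' tM' ->
    Jasso M' P' tM' X <-> rperp M' X /\ lperp (tM' * nu P')%type X.
  move=> [_ _ _ [fgP projP] _]; split.
    move=> [mX [fgX pX] [_ tX]]; split=> //; split=> //.
    by apply/hom_zero_prod; split=> //; exact: hom_zero_nu.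
  move=> [mX [fgX /hom_zero_prod[tX pX]]]; split=> //; split=> //.
  exact: hom_zero_of_nu.
have balE (A B M' P' tM' X : rmodType L) :
    corresponding_balanced_pair M' P' tM' A B ->
    (rperp A X /\ lperp B X <-> rperp M' X /\ lperp (tM' * nu P')%type X).
  by move=> [_ iA iB]; rewrite (rperp_iso X iA) (lperp_iso X iB).
split=> [X|A B corr X]; first exact: jassoE.
have JX : Jasso_balanced A B X <-> rperp A X /\ lperp B X.
  split=> [[M' [P' [tM' [rig' corr' /(jassoE _ _ _ _ rig')]]]]|h].
    by move/(balE _ _ _ _ _ _ corr').
  exists M, P, tM; split=> //; apply/jassoE => //.
  exact/(balE _ _ _ _ _ _ corr).
split=> //; rewrite JX (balE _ _ _ _ _ _ corr).
by split=> /jassoE; apply.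
Qed.
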